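(* Let $\lambda,\kappa$ be infinite cardinals and $\gamma$ a limit ordinal, and assume $R_\gamma(\lambda,\kappa,\omega)$. If $B$ is a Boolean algebra and $(a_\nu:\nu<\lambda)$ is a sequence in $B$, then one of the following holds: (a) there exists $A\subseteq\lambda$ of order type $\gamma$ such that $(a_\nu:\nu\in A)$ is independent; (b) there exist $n<\omega$ and a strictly increasing sequence $(\beta_\nu:\nu<\kappa)$ in $\lambda$ such that, letting $b_\nu=\bigcup_{k<n}\bigcap_{l<n}a_{\beta_{n^2\nu+nk+l}}$ for $\nu<\kappa$, the sequence $(b_\nu:\nu<\kappa)$ is constant; (c) there exists a strictly decreasing sequence in $B$ of length $\kappa$.
   Context: For infinite cardinals $\lambda,\kappa,\theta$ and an ordinal $\gamma$, $R_\gamma(\lambda,\kappa,\theta)$ means: for every $c:[\lambda]^{<\omega}\to\theta$ there exists $A\subseteq\lambda$ of order type $\gamma$ such that for every $u\in[A]^{<\omega}$ there exists $B\subseteq\lambda$ of order type $\kappa$ such that $c(w)=c(u)$ for all $w\in[B]^{|u|}$. Here $[X]^{<\omega}$ is the set of finite subsets of $X$ and $[X]^n$ the set of $n$-element subsets. A family in a Boolean algebra is independent if every finite nonempty meet of members or their complements (with distinct members) is nonzero. *)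

(* Defs.v *)
From mathcomp Require Export all_boot all_order finmap.
From mathcomp Require Export boolp classical_sets cardinality.
From mathcomp Require wochoice.

Set Implicit Arguments.
Unset Strict Implicit.
Unset Printing Implicit Defensive.

Import Order.TTheory.
Local Open Scope classical_set_scope.
Local Open Scope order_scope.

(* An ordinal is given by a well-ordered type, in which each element x stands
   for the ordinal that is the order type of its initial segment {y | y < x};
   a cardinal is an initial ordinal. *)

Definition is_ordinal d (T : orderType d) : Prop :=
  wochoice.well_order (<=%O : rel T).

Definition infinite_cardinal d (T : orderType d) : Prop :=
  [/\ is_ordinal T,
      infinite_set [set: T] &
      forall x : T, ~ ([set: T] #<= [set y : T | (y < x)%O])%card].

Definition limit_ordinal d (T : orderType d) : Prop :=
  [/\ is_ordinal T, [set: T] !=set0 & forall x : T, exists y : T, x < y].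

Definition same_order_type d d' (T : orderType d) (U : orderType d')
    (A : set T) (C : set U) : Prop :=
  exists2 f : T -> U,
    forall x y, A x -> A y -> x < y -> f x < f y & f @` A = C.

Definition has_order_type d d' (T : orderType d) (A : set T) (G : orderType d')
    : Prop :=
  same_order_type [set: G] A.

Definition ord_succ d (T : orderType d) (x : T) : T :=
  xget x [set z : T | x < z /\ forall y, x < y -> z <= y].

Definition ord_addn d (T : orderType d) (x : T) (n : nat) : T :=
  iter n (@ord_succ d T) x.

(* The ordinal product m x, that is, x successive blocks of length m: the order
   type of x * m ordered lexicographically with the coordinate in x first.  In
   an infinite cardinal the product exists and is unique, so the default value
   of xget is irrelevant; likewise for ord_succ. *)
Definition ord_muln d (T : orderType d) (m : nat) (x : T) : T :=
  xget x [set z : T | same_order_type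
    [set p : T *l nat | p.1 < x /\ (p.2 < m)%N] [set t : T | t < z]].

(* The partition relation R_G(L, K, theta), with theta the set of colours. *)
Definition Rrel dL dK dG (G : orderType dG) (L : orderType dL)
    (K : orderType dK) (theta : Type) : Prop :=
  forall c : {fset L} -> theta,
  exists2 A : set L, has_order_type A G &
    forall u : {fset L}, [set` u] `<=` A ->
    exists2 C : set L, has_order_type C K &
      forall w : {fset L}, [set` w] `<=` C -> #|` w|%fset = #|` u|%fset ->
      c w = c u.

(* Independence of the indexed family (a_i : i in A): distinct indices are
   required to carry distinct members. *)
Definition independent (I : choiceType) dB (B : ctbDistrLatticeType dB)
    (a : I -> B) (A : set I) : Prop :=
  forall (u : {fset I}) (eps : I -> bool),
    u != fset0 -> [set` u] `<=` A ->
    \meet_(i <- u) (if eps i then a i else Order.compl (a i)) <> \bot.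

(* Main.v *)
(* Colour a finite set u of indices by the 0/1-words e for which the meet of the
   a_i or their complements, chosen by e along u, is nonzero.  If the set A given
   by the partition relation is not independent, some word fails along a finite
   u in A, which can be prolonged at will because the type of A is limit; so
   there is a sequence of type kappa along which every finite set of bounded size
   realizes the same words, and some word is never realized.  Hence alternating
   words 0^n 1^n 0^n ... that are realized have bounded length.  If b_v = 0 then n
   of the a's in the v-th block of n^2 can be put to 0, if b_v = 1 then n of them
   to 1, and conversely n^2 equal letters decide b_v.  So if 0^n 1^n and 1^n 0^n
   are not realized for some large n, then b is constant; otherwise a realized
   alternation that cannot be lengthened yields a monotone sequence of type kappa,
   whose parameters all lie below the sequence. *)
Require Import Defs.
From mathcomp Require Import functions zify.

Set Implicit Arguments.
Unset Strict Implicit.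
Unset Printing Implicit Defensive.

Import Order.Theory.
Local Open Scope classical_set_scope.
Local Open Scope order_scope.

(** * Realized words in a Boolean algebra *)

Section Words.
Context {dB : Order.disp_t} {B : ctbDistrLatticeType dB}.
Implicit Types (x y z : B) (v : seq B) (e w : seq bool) (b : bool).

Definition lit x b : B := if b then x else ~` x.

Lemma litN x b : lit x (~~ b) = ~` lit x b.
Proof. by case: b => //=; rewrite complK. Qed.

Lemma le_litN0 x y b : y <= lit x b -> y <= lit x (~~ b) -> y = \bot.
Proof.
rewrite litN => h1 h2; apply/eqP.
by rewrite -lex0 -(meetxC (lit x b)) lexI h1.
Qed.

Definition holds y v e := all2 (fun x b => y <= lit x b) v e.

(** Phrased by a witness [y] rather than by the meet of the literals: shortening a word keeps [y],
    prolonging it only shrinks [y]. *)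
Definition realized v e := exists2 y, y != \bot & holds y v e.

Lemma holds_size y v e : holds y v e -> size v = size e.
Proof. by rewrite /holds all2E => /andP[/eqP]. Qed.

Lemma holds_le y z v e : z <= y -> holds y v e -> holds z v e.
Proof.
rewrite /holds => le_zy; elim: v e => [|x v IH] [|b e] //= /andP[h /IH ->].
by rewrite (le_trans le_zy h).
Qed.

Lemma holds_cat y v1 v2 e1 e2 : size v1 = size e1 ->
  holds y (v1 ++ v2) (e1 ++ e2) = holds y v1 e1 && holds y v2 e2.
Proof.
by elim: v1 e1 => [|x v1 IH] [|b e1] //= [/IH ->]; rewrite /holds /= andbA.
Qed.

Lemma holds_mask m y v e : holds y v e -> holds y (mask m v) (mask m e).
Proof.
rewrite /holds; elim: m v e => [|[] m IH] [|x v] [|b e] //= /andP[h /IH h'] //.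
by rewrite h.
Qed.

Lemma holds_nseq y v b : holds y v (nseq (size v) b) = all (fun x => y <= lit x b) v.
Proof. by rewrite /holds; elim: v => //= x v ->. Qed.

Lemma holds_meets y v e : size v = size e ->
  (y <= \meet_(p <- zip v e) lit p.1 p.2) = holds y v e.
Proof.
rewrite /holds; elim: v e => [|x v IH] [|b e] //=; first by rewrite big_nil lex1.
by move=> [/IH <-]; rewrite big_cons lexI.
Qed.

Lemma realized_size v e : realized v e -> size v = size e.
Proof. by move=> [y _ /holds_size]. Qed.

Lemma realized_meets v e : size v = size e ->
  realized v e <-> \meet_(p <- zip v e) lit p.1 p.2 != \bot.
Proof.
move=> sz; split; last by move=> h; exists (\meet_(p <- zip v e) lit p.1 p.2);
  rewrite // -holds_meets.
by move=> [y y0]; rewrite -holds_meets //; apply: contraTneq => ->; rewrite lex0.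
Qed.

Definition decides y x := (y <= x) || (y <= ~` x).

Lemma decides_le y z x : z <= y -> decides y x -> decides z x.
Proof.
by move=> h; rewrite /decides => /orP[] /(le_trans h) -> //; rewrite orbT.
Qed.

(** If [y] meets [x] in [\bot], it lies below the complement of [x]; otherwise it is cut down to
    that meet. Iterate along [v]. *)
Lemma decide y v : y != \bot ->
  exists z, [/\ z != \bot, z <= y & all (decides z) v].
Proof.
elim: v y => [|x v IH] y y0; first by exists y.
have [z [z0 zy zx]] : exists z, [/\ z != \bot, z <= y & decides z x].
  have [h|h] := eqVneq (y `&` x) \bot; last first.
    by exists (y `&` x); rewrite h leIl /decides leIr.
  by exists y; split=> //; rewrite /decides -disj_leC h eqxx orbT.
have [t [t0 tz tv]] := IH z z0; exists t; split=> //=.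
  exact: le_trans zy.
by rewrite (decides_le tz zx).
Qed.

Definition wordof y v := [seq y <= x | x <- v].

Lemma holds_wordof y v : all (decides y) v -> holds y v (wordof y v).
Proof.
rewrite /holds; elim: v => //= x v IH /andP[h /IH ->]; rewrite andbT /lit.
by move: h; rewrite /decides; case E: (y <= x) => /=.
Qed.

(** Lets words be padded to a fixed length, so that the colours of sets of that size control all
    shorter words. *)
Lemma realized_extend v e v' : realized v e ->
  exists2 e', size e' = size v' & realized (v ++ v') (e ++ e').
Proof.
move=> [y y0 hy]; have [z [z0 zy zv]] := decide v' y0.
exists (wordof z v'); first by rewrite size_map.
exists z => //; rewrite holds_cat ?(holds_size hy) //.
by rewrite (holds_le zy hy) holds_wordof.
Qed.

Lemma realized_prefix v e v' e' : size v = size e ->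
  realized (v ++ v') (e ++ e') -> realized v e.
Proof. by move=> sz [y y0]; rewrite holds_cat // => /andP[h _]; exists y. Qed.

Lemma realized_mask m v e : realized v e -> realized (mask m v) (mask m e).
Proof. by move=> [y y0 hy]; exists y => //; apply: holds_mask. Qed.

(** * Thickened and alternating words *)

Definition thick n w : seq bool := flatten [seq nseq n b | b <- w].

Lemma size_thick n w : size (thick n w) = (n * size w)%N.
Proof. by elim: w => [|b w IH] /=; rewrite ?muln0 // size_cat size_nseq IH mulnS. Qed.

Lemma thick_cat n w w' : thick n (w ++ w') = thick n w ++ thick n w'.
Proof. by rewrite /thick map_cat flatten_cat. Qed.

Lemma thick1 w : thick 1 w = w.
Proof. by elim: w => //= b w IH; rewrite /thick /= -/(thick 1 w) IH. Qed.

Lemma subseq_nseq (b : bool) n n' : (n <= n')%N -> subseq (nseq n b) (nseq n' b).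
Proof. by move=> h; rewrite -(subnK h) nseqD suffix_subseq. Qed.

Lemma subseq_thick n n' w : (n <= n')%N -> subseq (thick n w) (thick n' w).
Proof.
by move=> h; elim: w => //= b w IH; rewrite cat_subseq // subseq_nseq.
Qed.

Fixpoint alt b r : seq bool := if r is r'.+1 then b :: alt (~~ b) r' else [::].

Lemma size_alt b r : size (alt b r) = r.
Proof. by elim: r b => //= r IH b; rewrite IH. Qed.

Lemma altSr b r : alt b r.+1 = rcons (alt b r) (b (+) odd r).
Proof.
elim: r b => [|r IH] b; first by rewrite /= addbF.
by rewrite -[alt b r.+2]/(b :: alt (~~ b) r.+1) IH /= addbN addNb.
Qed.

(** Two consecutive letters of an alternating word are distinct, so each letter of [e] is found in a
    pair of its own. *)
Lemma subseq_alt e b : subseq e (alt b (size e).*2).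
Proof.
elim: e b => [|c e IH] b; first exact: sub0seq.
have altSS r : alt b r.+2 = [:: b, ~~ b & alt b r] by rewrite /= negbK.
rewrite [size _]/= doubleS altSS.
rewrite -[_ :: e]cat1s -[b :: _]/([:: b; ~~ b] ++ _) cat_subseq //.
by rewrite sub1seq !inE; case: c; case: (b).
Qed.

End Words.

(** * Arithmetic of ordinals without maximum *)

Section WellOrder.
Context {d : Order.disp_t} {T : orderType d}.
Context (woT : is_ordinal T).
Implicit Types (x y z l : T) (P : T -> Prop).

Lemma ordinal_min P : (exists x, P x) ->
  exists z, P z /\ forall y, P y -> z <= y.
Proof.
move=> [x Px]; have [|z [[Pz zP] _]] := @woT [pred x | `[< P x >]].
  by exists x; apply/asboolP.
exists z; split=> [|y Py]; first exact/asboolP.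
by apply: zP; apply/asboolP.
Qed.

Lemma ordinal_ind P :
  (forall x, (forall y, y < x -> P y) -> P x) -> forall x, P x.
Proof.
move=> IH x; apply: contrapT => nPx.
have [z [nPz zP]] := @ordinal_min (fun x => ~ P x) (ex_intro _ x nPx).
apply: nPz; apply: IH => y yz; apply: contrapT => /zP.
by rewrite leNgt yz.
Qed.

(** Were [z < z'], the segment below [z'] would map increasingly into the one below [z]; but an
    increasing map of a well-order into itself satisfies [t <= f (g t)], which fails at [z]. *)
Lemma initial_segment_inj d' (U : orderType d') (S : set U) z z' :
  same_order_type S [set t | t < z] -> same_order_type S [set t | t < z'] ->
  z = z'.
Proof.
move=> h h'; wlog lt_zz' : z z' h h' / z < z' => [hw|].
  by case: (ltgtP z z') => // lt_zz'; [|symmetry]; apply: hw.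
case: h h' => f fm fS [f' fm' fS'].
have [g gP] : exists g : T -> U, forall t, t < z' -> S (g t) /\ f' (g t) = t.
  suff /choice[g gP] : forall t, exists s, t < z' -> S s /\ f' s = t by exists g.
  move=> t.
  have [tz'|ntz'] := pselect (t < z'); last first.
    have : [set t | t < z'] z by [].
    by rewrite -fS' => -[s _ _]; exists s => /ntz'.
  have : [set t | t < z'] t by [].
  by rewrite -fS' => -[s Ss <-]; exists s.
have lt_g t t' : t < t' -> t' < z' -> f (g t) < f (g t').
  move=> tt' t'z'; have tz' := lt_trans tt' t'z'.
  have [[Sg Eg] [Sg' Eg']] := (gP _ tz', gP _ t'z').
  apply: fm => //; rewrite ltNge; apply/negP; rewrite le_eqVlt => /orP[/eqP E|/fm'].
    by move: tt'; rewrite -Eg -Eg' E ltxx.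
  by rewrite Eg Eg' => /(_ Sg' Sg); rewrite ltNge ltW.
have ge_g t : t < z' -> t <= f (g t).
  elim/ordinal_ind: t => t IH tz'; rewrite leNgt; apply/negP => lt_t.
  have := IH _ lt_t (lt_trans lt_t tz').
  by rewrite leNgt lt_g.
have : [set t | t < z] (f (g z)) by rewrite -fS; exists (g z) => //; case: (gP z).
by move=> /=; rewrite ltNge ge_g.
Qed.

Context (noMax : forall x, exists y, x < y).

(** Without a maximum the set given to [xget] is nonempty, so the default value never arises. *)
Lemma ord_succP x : x < ord_succ x /\ forall y, x < y -> ord_succ x <= y.
Proof.
apply: (@xgetPex T x [set z | x < z /\ forall y, x < y -> z <= y]).
exact: ordinal_min (noMax x).
Qed.

Lemma ord_succ_gt x : x < ord_succ x. Proof. by case: (ord_succP x). Qed.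

Lemma ord_succ_le x y : (ord_succ x <= y) = (x < y).
Proof.
apply/idP/idP; first exact/lt_le_trans/ord_succ_gt.
by case: (ord_succP x) => _; apply.
Qed.

Lemma ord_succ_lt x y : x < y -> ord_succ x < ord_succ y.
Proof. by rewrite -ord_succ_le => /le_lt_trans; apply; apply: ord_succ_gt. Qed.

Lemma ord_addnA x m n : ord_addn (ord_addn x m) n = ord_addn x (m + n)%N.
Proof. by rewrite /ord_addn addnC iterD. Qed.

Lemma ord_addn_lt x y n : x < y -> ord_addn x n < ord_addn y n.
Proof. by move=> xy; elim: n => //= n; apply: ord_succ_lt. Qed.

Lemma ord_addn_ltn x m n : (m < n)%N -> ord_addn x m < ord_addn x n.
Proof.
elim: n => // n IH; rewrite ltnS leq_eqVlt => /predU1P[->|/IH h].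
  exact: ord_succ_gt.
exact: lt_trans (ord_succ_gt _).
Qed.

Lemma ord_addn_ge x n : x <= ord_addn x n.
Proof. by case: n => // n; apply/ltW/(@ord_addn_ltn x 0). Qed.

(* Zero counts as a limit. *)
Definition is_limit l := forall x, x < l -> ord_succ x < l.

Lemma limit_addn_lt l x n : is_limit l -> x < l -> ord_addn x n < l.
Proof. by move=> ll xl; elim: n => //= n; apply: ll. Qed.

(** By induction: an [x] that is not a limit is the successor of a smaller element, which already
    has a decomposition. *)
Lemma limit_decomp x : exists p : T * nat, is_limit p.1 /\ x = ord_addn p.1 p.2.
Proof.
elim/ordinal_ind: x => x IH; have [lx|] := pselect (is_limit x).
  by exists (x, 0%N).
move=> /existsNP[y /not_implyP[yx /negP]]; rewrite -leNgt => xy.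
have [[l n] /= [ll Ey]] := IH _ yx; exists (l, n.+1); split=> //.
rewrite -[RHS]/(ord_succ (ord_addn l n)) -Ey.
by apply/eqP; rewrite eq_le xy ord_succ_le.
Qed.

(** Finitely many successors never lead from below a limit up to it, so the limit parts are compared
    first. *)
Lemma limit_addn_ltE l1 l2 n1 n2 : is_limit l1 -> is_limit l2 ->
  (ord_addn l1 n1 < ord_addn l2 n2) = (l1 < l2) || (l1 == l2) && (n1 < n2)%N.
Proof.
move=> L1 L2; have lt_addn l l' n n' : is_limit l' -> l < l' ->
    ord_addn l n < ord_addn l' n'.
  by move=> L' h; apply: lt_le_trans (ord_addn_ge _ _); apply: limit_addn_lt.
case: (ltgtP l1 l2) => [h|h|->] /=; first exact: lt_addn.
  by apply/negbTE; rewrite -leNgt ltW // lt_addn.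
case: (ltngtP n1 n2) => [h|h|->]; first exact: ord_addn_ltn.
  by apply/negbTE; rewrite -leNgt ltW // ord_addn_ltn.
by rewrite ltxx.
Qed.

Lemma limit_addn_inj l1 l2 n1 n2 : is_limit l1 -> is_limit l2 ->
  ord_addn l1 n1 = ord_addn l2 n2 -> l1 = l2 /\ n1 = n2.
Proof.
move=> L1 L2 E.
have := @limit_addn_ltE _ _ n1 n2 L1 L2; have := @limit_addn_ltE _ _ n2 n1 L2 L1.
by rewrite E ltxx; case: (ltgtP l1 l2) => //= ->; case: (ltngtP n1 n2) => //= ->.
Qed.

(* Since m * omega = omega, only the finite part of the argument is multiplied;
   hence the product exists in T as soon as T has no maximum. *)
Lemma ord_muln_limit m l n : (0 < m)%N -> is_limit l ->
  ord_muln m (ord_addn l n) = ord_addn l (m * n)%N.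
Proof.
move=> m0 Ll; have [f fP] := choice limit_decomp.
(* The isomorphism keeps the limit part of [p.1] and starts its block at [m] times the finite
   part. *)
pose g (p : T *l nat) := ord_addn (f p.1).1 (m * (f p.1).2 + p.2)%N.
have lt_block i j k : (i < j)%N -> (k < m)%N -> (m * i + k < m * j)%N.
  move=> ij km; apply: (@leq_trans (m * i.+1)); last by rewrite leq_mul2l ij orbT.
  by rewrite mulnS addnC ltn_add2r.
have gP : same_order_type
    [set p : T *l nat | p.1 < ord_addn l n /\ (p.2 < m)%N]
    [set t : T | t < ord_addn l (m * n)%N].
  exists g.
    move=> [x i] [y j] /= [xl im] [yl jm]; rewrite ltxi_pair /g /= => /andP[].
    have [[Lx Ex] [Ly Ey]] := (fP x, fP y).
    rewrite le_eqVlt => /predU1P[-> |xy] h.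
      by apply: ord_addn_ltn; move: h; rewrite lexx ltn_add2l.
    move: xy; rewrite {1}Ex {1}Ey !limit_addn_ltE // => /orP[->//|/andP[->] h'].
    by apply/orP; right; apply: leq_trans (leq_addr _ _); apply: lt_block.
  apply/seteqP; split=> [_ [[x i] /= [xl im] <-]|t /= tl].
    have [Lx Ex] := fP x; move: xl; rewrite {1}Ex /g /= !limit_addn_ltE //.
    by move=> /orP[->//|/andP[-> h]]; rewrite lt_block // orbT.
  (* Dividing the finite part of [t] by [m] gives the block as quotient and the position in it as
     remainder. *)
  have [Lt Et] := fP t; pose x := ord_addn (f t).1 ((f t).2 %/ m).
  have [Lx Ex] := fP x.
  have [E1 E2] := limit_addn_inj Lt Lx Ex.
  exists (x, ((f t).2 %% m)%N) => /=; last first.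
    by rewrite /g /= -E1 -E2 mulnC -divn_eq -Et.
  split; last by rewrite ltn_mod.
  by move: tl; rewrite {1}Et !limit_addn_ltE // ltn_divLR // mulnC.
apply/esym/(initial_segment_inj gP).
apply: (@xgetPex T _ [set z | same_order_type
  [set p : T *l nat | p.1 < ord_addn l n /\ (p.2 < m)%N] [set t | t < z]]).
by exists (ord_addn l (m * n)%N).
Qed.

Lemma ord_muln_lt m x y : (0 < m)%N -> x < y ->
  ord_addn (ord_muln m x) m <= ord_muln m y.
Proof.
move=> m0; have [[l n] /= [Ll ->]] := limit_decomp x.
have [[l' n'] /= [Ll' ->]] := limit_decomp y.
rewrite !ord_muln_limit // ord_addnA limit_addn_ltE // -mulnSr.
rewrite leNgt limit_addn_ltE //.
by case: ltgtP => //= _; rewrite ltn_mul2l m0 /= ltnS -ltnNge.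
Qed.

End WellOrder.

(** An infinite set injects into itself minus a point; if that point were a maximum [x], the type
    would inject into the segment below [x]. *)
Lemma infinite_cardinal_unbounded d (T : orderType d) :
  infinite_cardinal T -> forall x : T, exists y, x < y.
Proof.
move=> [_ /infiniteP/card_leP[f] initT] x; apply: contrapT => /forallNP xmax.
have {xmax} xmax y : y <= x by rewrite leNgt; apply/negP/xmax.
apply: (initT x); pose g n := val (f (to_setT n)).
have g_inj : injective g.
  move=> m n /val_inj /(@inj _ _ _ f) E.
  suff : to_setT m = to_setT n by case.
  by apply: E; rewrite inE.
(* Shift along the copy [g] of the natural numbers, which frees the value [g 0]. *)
pose h y := if pselect (exists n, y = g n) is left e then g (projT1 (cid e)).+1 else y.
have hg n : h (g n) = g n.+1.
  rewrite /h; case: pselect => [e|[]]; last by exists n.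
  by case: cid => /= m /g_inj ->.
have hN y : ~ (exists n, y = g n) -> h y = y by rewrite /h; case: pselect.
have h_inj : injective h.
  move=> y z; have [[m ->]|ny] := pselect (exists n, y = g n);
  have [[n ->]|nz] := pselect (exists n, z = g n); rewrite ?hg ?hN //.
  - by move=> /g_inj[->].
  - by move=> E; case: nz; exists m.+1.
  - by move=> E; case: ny; exists n.+1.
have h0 y : h y != g 0%N.
  apply/eqP; have [[m ->]|ny] := pselect (exists n, y = g n).
    by rewrite hg => /g_inj.
  by rewrite hN // => E; case: ny; exists 0%N.
have /injfunPex[k] : exists2 k : T -> T,
    set_fun [set: T] [set y | y < x] k & set_inj [set: T] k.
  (* Whatever [h] sends to [x] is redirected to the freed [g 0]. *)
  exists (fun y => if h y == x then g 0%N else h y).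
    move=> y _ /=; case: eqP => [E|/eqP]; rewrite lt_neqAle xmax andbT //.
    by rewrite -E eq_sym.
  move=> y z _ _ /=.
  case: (h y =P x) => [Ey|_]; case: (h z =P x) => [Ez|_].
  - by move=> _; apply: h_inj; rewrite Ey.
  - by move=> E; have := h0 z; rewrite -E eqxx.
  - by move=> E; have := h0 y; rewrite E eqxx.
  - exact: h_inj.
exact: inj_card_le.
Qed.

(** * Blocks *)

Section Blocks.
Context {dK dB : Order.disp_t} {K : orderType dK} {B : ctbDistrLatticeType dB}.
Context (woK : is_ordinal K) (noMax : forall x : K, exists y, x < y) (a : K -> B).
Implicit Types (u v : K) (s vs : seq K) (y : B) (e w : seq bool).

Definition chunk m v : seq K := [seq ord_addn (ord_muln m v) j | j <- iota 0 m].

(** The b_v of the theorem, the subsequence [beta] being absorbed into [a]. *)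
Definition block n v : B := \join_(k < n) \meet_(l < n)
  a (ord_addn (ord_addn (ord_muln (n ^ 2)%N v) (n * k)%N) l).

Lemma size_chunk m v : size (chunk m v) = m.
Proof. by rewrite size_map size_iota. Qed.

Lemma size_flatten_chunk m vs :
  size (flatten [seq chunk m v | v <- vs]) = (m * size vs)%N.
Proof.
by elim: vs => [|v vs IH] /=; rewrite ?muln0 // size_cat size_chunk IH mulnS.
Qed.

Lemma mem_chunk m v j : (j < m)%N -> ord_addn (ord_muln m v) j \in chunk m v.
Proof. by move=> jm; rewrite map_f // mem_iota. Qed.

Lemma chunk_lt m u v (x x' : K) : u < v -> x \in chunk m u -> x' \in chunk m v -> x < x'.
Proof.
move=> uv /mapP[i]; rewrite mem_iota /= => im -> /mapP[j _ ->].
have m0 : (0 < m)%N by apply: leq_trans im.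
apply: lt_le_trans (ord_addn_ge woK noMax _ _).
by apply: lt_le_trans (ord_muln_lt woK noMax m0 uv); apply: (ord_addn_ltn woK noMax).
Qed.

Lemma sorted_addn (x : K) i m :
  sorted <%O [seq ord_addn x j | j <- iota i m].
Proof.
by rewrite sorted_map; apply: sub_sorted (iota_ltn_sorted i m) => j k; apply: (ord_addn_ltn woK noMax).
Qed.

Lemma sorted_flatten_sub m (g : K -> seq K) vs : sorted <%O vs ->
  (forall v, v \in vs -> sorted <%O (g v)) ->
  (forall v, v \in vs -> {subset g v <= chunk m v}) ->
  sorted <%O (flatten [seq g v | v <- vs]).
Proof.
rewrite !(sorted_pairwise lt_trans); elim: vs => //= v vs IH /andP[hv hvs] sg subg.
rewrite pairwise_cat -!(sorted_pairwise lt_trans) sg ?mem_head //=.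
apply/andP; split; last first.
  rewrite (sorted_pairwise lt_trans) IH // => u hu; [apply: sg|apply: subg];
  by rewrite inE hu orbT.
apply/allrelP => x y hx /flatten_mapP[u hu hy].
apply: (@chunk_lt m v u); first by move/allP: hv; apply.
  by apply: subg hx; rewrite mem_head.
by apply: subg hy; rewrite inE hu orbT.
Qed.

Lemma sorted_flatten_chunk m vs : sorted <%O vs ->
  sorted <%O (flatten [seq chunk m v | v <- vs]).
Proof.
by move=> h; apply: (@sorted_flatten_sub m) => // v _; [apply: sorted_addn|move]. Qed.

Lemma block_index n (k l : 'I_n) : (n * k + l < n ^ 2)%N.
Proof. by case: k l => k hk [l hl] /=; nia. Qed.

(** View the chunk as an n by n array: the first row forces the value true, the first entries of all
    rows force false. *)
Lemma block_lit n v y b : (0 < n)%N ->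
  (forall x, x \in chunk (n ^ 2) v -> y <= lit (a x) b) -> y <= lit (block n v) b.
Proof.
move=> n0 h.
have {}h (k l : 'I_n) :
    y <= lit (a (ord_addn (ord_addn (ord_muln (n ^ 2)%N v) (n * k)%N) l)) b.
  by apply: h; rewrite ord_addnA mem_chunk // block_index.
case: b h => /= h; rewrite /block.
  by apply: (@joins_min _ _ _ (Ordinal n0)) => //; apply/meetsP => l _; apply: h.
rewrite compl_joins; apply/meetsP => k _; rewrite compl_meets.
by apply: (@joins_min _ _ _ (Ordinal n0)) => //; apply: h.
Qed.

(** Either some row of the n by n array is true throughout, which makes the block true and supplies
    n true entries, or every row has a false entry, which makes it false and supplies n false
    ones. *)
Lemma block_lit_inv n v y b : y != \bot -> y <= lit (block n v) b ->
  all (fun x => decides y (a x)) (chunk (n ^ 2) v) ->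
  exists s, [/\ sorted <%O s, size s = n, {subset s <= chunk (n ^ 2) v} &
    all (fun x => y <= lit (a x) b) s].
Proof.
move=> y0 yb /allP dec.
pose i (k l : 'I_n) := ord_addn (ord_muln (n ^ 2)%N v) (n * k + l).
have ic k l : i k l \in chunk (n ^ 2) v by rewrite mem_chunk // block_index.
have blockE : block n v = \join_(k < n) \meet_(l < n) a (i k l).
  by apply: eq_bigr => k _; apply: eq_bigr => l _; rewrite ord_addnA.
(* A nonzero [y] lies below at most one of the two literals, so the case found must agree with
   [b]. *)
have b_of b' : y <= lit (block n v) b' -> b = b'.
  move=> yb'; apply/eqP; apply: contraNT y0 => bb'.
  have {}bb' : b' = ~~ b by case: (b) (b') bb' => [] [].
  by apply/eqP; apply: (le_litN0 yb); rewrite -bb'.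
have sorted_ord (g : 'I_n -> K) :
    (forall k l : 'I_n, (k < l)%N -> g k < g l) -> sorted <%O (map g (enum 'I_n)).
  move=> gm; rewrite sorted_map; apply: (@sub_sorted _ (relpre val ltn)) => //.
  by rewrite -sorted_map val_enum_ord iota_ltn_sorted.
have [[k hk]|/forallNP hk] := pselect (exists k, forall l, y <= a (i k l)).
  have -> : b = true.
    by apply: b_of; rewrite blockE; apply: (joins_min (j := k)) => //; apply/meetsP.
  exists [seq i k l | l <- enum 'I_n]; split.
  - by apply: sorted_ord => l l' ll'; apply: (ord_addn_ltn woK noMax); rewrite ?ltn_add2l.
  - by rewrite size_map size_enum_ord.
  - by move=> _ /mapP[l _ ->].
  - by apply/allP => _ /mapP[l _ ->]; apply: hk.
have /choice[f hf] : forall k, exists l, y <= ~` a (i k l).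
  move=> k; have /existsNP[l /negP hl] := hk k; exists l.
  by have := dec _ (ic k l); rewrite /decides (negbTE hl).
have -> : b = false.
  apply: b_of; rewrite blockE /= compl_joins; apply/meetsP => k _; rewrite compl_meets.
  by apply: (joins_min (j := f k)).
exists [seq i k (f k) | k <- enum 'I_n]; split.
(* One entry per row gives an increasing sequence, as the rows are consecutive intervals. *)
- apply: sorted_ord => k l kl; apply: (ord_addn_ltn woK noMax) => //.
  by case: (f k) (f l) => p hp [q hq] /=; nia.
- by rewrite size_map size_enum_ord.
- by move=> _ /mapP[k _ ->].
- by apply/allP => _ /mapP[k _ ->]; apply: hf.
Qed.

Definition occurs e := exists2 s, sorted <%O s & realized [seq a x | x <- s] e.

Lemma occurs_subseq e e' : subseq e e' -> occurs e' -> occurs e.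
Proof.
move=> /subseqP[m _ ->] [s ss rs]; exists (mask m s).
  exact: (subseq_sorted lt_trans (mask_subseq m s)).
by rewrite map_mask; apply: realized_mask.
Qed.

(** Shrink the witness until it decides every [a x] in the chunks; each chunk then supplies n
    indices carrying the letter of its block. *)
Lemma occurs_block n vs w : (0 < n)%N -> sorted <%O vs ->
  realized [seq block n v | v <- vs] w -> occurs (thick n w).
Proof.
move=> n0 svs [y0 y00 hy0].
have [y [yn0 yy0 dec]] :=
  decide [seq a x | x <- flatten [seq chunk (n ^ 2) v | v <- vs]] y00.
have hy := holds_le yy0 hy0.
have [g [sg subg hg]] : exists g : K -> seq K,
    [/\ forall v, v \in vs -> sorted <%O (g v),
        forall v, v \in vs -> {subset g v <= chunk (n ^ 2) v} &
        holds y [seq a x | x <- flatten [seq g v | v <- vs]] (thick n w)].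
  elim: vs w svs dec hy {hy0} => [|v vs IH] [|b w] //; first by exists (fun=> [::]).
  move=> /= svs; rewrite map_cat all_cat => /andP[dec decs] /andP[hv hvs].
  have [g [sg subg hg]] := IH _ (path_sorted svs) decs hvs.
  have [s [ss sz subs hs]] : exists s, [/\ sorted <%O s, size s = n,
      {subset s <= chunk (n ^ 2) v} & all (fun x => y <= lit (a x) b) s].
    by apply: block_lit_inv hv _ => //; move: dec; rewrite all_map.
  have v_notin : v \notin vs.
    by move: svs; rewrite (path_sortedE lt_trans) => /andP[/allP h _];
      apply/negP => /h; rewrite ltxx.
  exists (fun u => if u == v then s else g u); split.
  - by move=> u; rewrite inE; case: eqP => [->|_ /sg].
  - by move=> u; rewrite inE; case: eqP => [->|_ /subg].
  rewrite /= eqxx map_cat /thick /= holds_cat ?size_map ?size_nseq //.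
  have -> : nseq n b = nseq (size [seq a x | x <- s]) b by rewrite size_map sz.
  rewrite holds_nseq all_map hs /=.
  suff -> : [seq if u == v then s else g u | u <- vs] = [seq g u | u <- vs] by [].
  by apply/eq_in_map => u uvs; case: eqP v_notin => // <-; rewrite uvs.
exists (flatten [seq g v | v <- vs]); last by exists y.
exact: sorted_flatten_sub subg.
Qed.

(** The way back from indices to blocks, at a higher price: all n^2 indices of a chunk carry the
    letter. *)
Lemma realized_block n vs w : (0 < n)%N -> size vs = size w ->
  realized [seq a x | x <- flatten [seq chunk (n ^ 2) v | v <- vs]]
    (thick (n ^ 2) w) ->
  realized [seq block n v | v <- vs] w.
Proof.
move=> n0 sz [y y0 hy]; exists y => //.
elim: vs w sz hy => [|v vs IH] [|b w] //= [sz].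
rewrite map_cat /thick /= holds_cat ?size_map ?size_iota ?size_nseq //.
move=> /andP[hv hvs]; rewrite /holds /= [X in _ && X]IH // andbT.
apply: block_lit => // x xc; move: hv.
have -> : nseq (n ^ 2) b = nseq (size [seq a x | x <- chunk (n ^ 2) v]) b.
  by rewrite size_map size_chunk.
rewrite holds_nseq => /allP; apply.
exact: map_f.
Qed.

(** If [block n u] is not below [block n v], the blocks realize the word 10, so that 1^n 0^n occurs;
    the converse inequality uses 01. *)
Lemma block_const n : (0 < n)%N ->
  ~ occurs (thick n (alt true 2)) -> ~ occurs (thick n (alt false 2)) ->
  forall u v, block n u = block n v.
Proof.
move=> n0 nt nf u v; wlog uv : u v / u < v => [hw|].
  by case: (ltgtP u v) => [|/hw ->|->] //; apply: hw.
have suv : sorted <%O [:: u; v] by rewrite /= uv.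
apply/eqP; rewrite eq_le; apply/andP; split; apply: contrapT => hle.
  apply: nt; apply: (occurs_block n0 suv); apply/realized_meets => //.
  apply/eqP; rewrite /= !big_cons big_nil /= meetx1 => h; apply: hle.
  by rewrite -[block n v]complK -disj_leC h.
apply: nf; apply: (occurs_block n0 suv); apply/realized_meets => //.
apply/eqP; rewrite /= !big_cons big_nil /= meetx1 => h; apply: hle.
by rewrite -[block n u]complK -disj_leC meetC h.
Qed.

(** * Sequences homogeneous for words of bounded length *)

Context (N : nat) (x0 : K).
Context (hom : forall e s s', sorted <%O s -> sorted <%O s' ->
  size s = size s' -> (size s <= N)%N ->
  realized [seq a x | x <- s] e -> realized [seq a x | x <- s'] e).

Lemma occurs_realized e s : occurs e -> (size e <= N)%N -> sorted <%O s ->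
  size s = size e -> realized [seq a x | x <- s] e.
Proof.
move=> [s' ss' rs'] eN ss sz.
have sz' : size s' = size e by rewrite -(realized_size rs') size_map.
by apply: (hom ss' ss) rs'; rewrite ?sz' ?sz.
Qed.

(* Below the first q + 1 blocks, maximality of the alternation leaves only one
   direction of change, so the later blocks are monotone.  The factor 2 splits
   the last but one letter of the alternating word over two blocks, which makes
   the chain strict. *)
Lemma block_chain n n' q b : (0 < n)%N -> (2 * n ^ 2 <= n')%N ->
  (n' * q.+2 <= N)%N -> occurs (thick n' (alt b q.+2)) ->
  ~ occurs (thick n (alt b q.+3)) ->
  exists s : K -> B, forall u v, u < v -> s v < s u.
Proof.
move=> n0 nn' hN occ nocc.
(* The last letter of [alt b q.+2]; the letter before it is [~~ c]. *)
pose c := b (+) odd q.+1.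
have alt1 : alt b q.+1 = rcons (alt b q) (~~ c) by rewrite altSr /c /= addbN negbK.
have alt2 : alt b q.+2 = rcons (alt b q.+1) c by rewrite altSr.
have alt3 : alt b q.+3 = alt b q.+1 ++ [:: c; ~~ c].
  by rewrite altSr alt2 -!cats1 -catA /c /= !addbN.
have [bot [_ botP]] := @ordinal_min _ _ woK (fun=> True) (ex_intro _ x0 I).
pose bs := [seq ord_addn bot j | j <- iota 0 q.+1].
(* Shifting by [q.+1] keeps the blocks of the chain above the parameters [bs]. *)
pose h v := ord_addn v q.+1.
have sz_bs : size bs = q.+1 by rewrite size_map size_iota.
have sorted_bs u v : u < v -> sorted <%O (bs ++ [:: h u; h v]).
  move=> uv; rewrite (sorted_pairwise lt_trans) pairwise_cat.
  have lt_h (x : K) j : (j < q.+1)%N -> ord_addn bot j < h x.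
    move=> jq; apply: (@lt_le_trans _ _ (ord_addn bot q.+1)).
      exact: (ord_addn_ltn woK noMax).
    have := botP x I; rewrite le_eqVlt => /predU1P[->//|].
    by move=> /(ord_addn_lt woK noMax q.+1)/ltW.
  apply/and3P; split.
  - apply/allrelP => x x' /mapP[j]; rewrite mem_iota => jq ->.
    by rewrite !inE => /orP[] /eqP ->; apply: lt_h.
  - by rewrite -(sorted_pairwise lt_trans) sorted_addn.
  - by rewrite /= (ord_addn_lt woK noMax _ uv).
pose sigma := \meet_(p <- zip [seq block n v | v <- bs] (alt b q.+1)) lit p.1 p.2.
have sz_sigma : size [seq block n v | v <- bs] = size (alt b q.+1).
  by rewrite size_map sz_bs size_alt.
have le_sigma y v1 v2 b1 b2 :
    holds y [seq block n v | v <- bs ++ [:: v1; v2]] (alt b q.+1 ++ [:: b1; b2]) =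
    [&& y <= sigma, y <= lit (block n v1) b1 & y <= lit (block n v2) b2].
  by rewrite map_cat holds_cat // holds_meets // /holds /= andbT.
exists (fun v => sigma `&` lit (block n (h v)) (~~ c)) => u v uv.
(* A failure would realize [c] at [h u] and [~~ c] at [h v] on top of [sigma], hence the forbidden
   alternation of [q.+3] letters. *)
have le_uv : sigma `&` lit (block n (h v)) (~~ c) <= lit (block n (h u)) (~~ c).
  apply: contrapT => nle; apply: nocc; apply: (occurs_block n0 (sorted_bs _ _ uv)).
  exists (sigma `&` lit (block n (h v)) (~~ c) `&` lit (block n (h u)) c).
    by rewrite disj_leC -litN; apply/negP.
  by rewrite alt3 le_sigma leIr /= -meetA leIl leIxr // leIl.
rewrite lt_neqAle lexI leIl le_uv !andbT; apply/eqP => E.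
(* Here the last two [~~ c] form a single run of length 2 n^2 after thickening, which fits into one
   run of length [n']. The witness obtained separates the terms at [u] and [v]. *)
have [y y0] : realized [seq block n v | v <- bs ++ [:: h u; h v]]
    (alt b q.+1 ++ [:: ~~ c; c]).
  apply: realized_block => //; first by rewrite !size_cat sz_bs size_alt.
  apply: occurs_realized; last 2 first.
  - exact/sorted_flatten_chunk/sorted_bs.
  - by rewrite size_thick size_flatten_chunk !size_cat sz_bs size_alt.
  - apply: occurs_subseq occ.
    rewrite alt2 alt1 -!cats1 -catA /= !thick_cat -catA cat_subseq //.
      by apply: subseq_thick; lia.
    rewrite /thick /= !cats0 catA cat_subseq // -?nseqD subseq_nseq //; lia.
  - rewrite size_thick size_cat size_alt addn2; apply: leq_trans hN.
    by move: nn' n0; clear; nia.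
rewrite le_sigma => /and3P[ys yu yv]; case/negP: y0; apply/eqP.
apply: (le_litN0 yv).
have : y <= sigma `&` lit (block n (h u)) (~~ c) by rewrite lexI ys.
by rewrite -E lexI => /andP[].
Qed.

(** The recursion is the bound on [n'] in [block_chain], so one index down pays for one more
    alternation. *)
Fixpoint thickness i : nat := if i is i'.+1 then (2 * thickness i' ^ 2)%N else 1.

Lemma thickness_gt0 i : (0 < thickness i)%N.
Proof. by elim: i => //= i IH; rewrite muln_gt0 /= expn_gt0 IH. Qed.

Lemma leq_thickness i j : (i <= j)%N -> (thickness i <= thickness j)%N.
Proof.
apply: (@homo_leq _ thickness leq) => [//|k l m|k /=]; first exact: leq_trans.
by have := thickness_gt0 k; nia.
Qed.

(* Were both conclusions false, block_chain would trade each step down in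
   thickness for one more alternation, starting from 2 alternating letters at
   thickness k; at thickness 1 every word of length k / 2 would then occur. *)
Lemma block_const_or_chain eps (k := (size eps).*2) :
  (thickness k * k.+2 <= N)%N -> ~ occurs eps ->
  (exists2 n, (0 < n)%N & forall u v, block n u = block n v) \/
  exists s : K -> B, forall u v, u < v -> s v < s u.
Proof.
move=> hN neps; have [hs|nchain] := pselect (exists s : K -> B, forall u v, u < v -> s v < s u).
  by right.
left; exists (thickness k); first exact: thickness_gt0.
pose alternates i r := exists b, occurs (thick (thickness i) (alt b r)).
have step i r : (i < k)%N -> (r < k)%N -> alternates i.+1 r.+2 -> alternates i r.+3.
  move=> ik rk [b hb]; exists b; apply: contrapT => nb; apply: nchain.
  apply: block_chain hb nb => //; first exact: thickness_gt0.
  by apply: leq_trans hN; rewrite leq_mul // ?leq_thickness // !ltnS ltnW.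
have nalt : ~ alternates k 2.
  move=> hk; have H j : (j <= k)%N -> alternates (k - j)%N j.+2.
    elim: j => [|j IH] jk; first by rewrite subn0.
    by apply: step => //; [lia|rewrite -subSn // subSS; apply/IH/ltnW].
  have := H k (leqnn k); rewrite subnn => -[b]; rewrite [thickness _]/= thick1.
  (* The alternation reached has [k.+2] letters; its first [k], twice the size of [eps], already
     contain [eps]. *)
  apply: contra_not neps; apply: occurs_subseq.
  apply: (subseq_trans (subseq_alt eps b)).
  by rewrite (altSr b k.+1) (altSr b k) -!cats1 -catA prefix_subseq.
apply: block_const; first exact: thickness_gt0.
  by move=> h; apply: nalt; exists true.
by move=> h; apply: nalt; exists false.
Qed.

End Blocks.

(** * From the partition relation to words *)

Lemma sorted_extend d (T : orderType d) (x0 : T) (s : seq T) n :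
  is_ordinal T -> (forall x : T, exists y, x < y) -> sorted <%O s ->
  exists2 t, size t = n & sorted <%O (s ++ t).
Proof.
(* The iota starts at 1 to stay strictly above the last element; [x0] replaces that element when [s]
   is empty. *)
move=> woT noMax ss; exists [seq ord_addn (last x0 s) j | j <- iota 1 n].
  by rewrite size_map size_iota.
have st := sorted_addn woT noMax (last x0 s) 0 n.+1.
case: s ss st => [|x s] /= ss; first exact: path_sorted.
by rewrite cat_path ss.
Qed.

Lemma sort_fset_seq d (T : orderType d) (s : seq T) :
  sorted <%O s -> sort <=%O [fset x in s]%fset = s.
Proof.
move=> ss; apply: lt_sorted_eq => //; first by rewrite sort_lt_sorted fset_uniq.
by move=> x; rewrite mem_sort !inE.
Qed.

(** The colour is a numerical code of the finite list of words realized along the increasing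
    enumeration. *)
Lemma realized_colouring dL dB (L : orderType dL) (B : ctbDistrLatticeType dB)
    (a : L -> B) :
  exists c : {fset L} -> nat, forall s s', sorted <%O s -> sorted <%O s' ->
    size s = size s' -> c [fset x in s]%fset = c [fset x in s']%fset ->
    forall e, realized [seq a x | x <- s] e -> realized [seq a x | x <- s'] e.
Proof.
pose words (s : seq L) : seq (seq bool) :=
  [seq e <- [seq val e | e <- enum {: (size s).-tuple bool}] |
    `[< realized [seq a x | x <- s] e >]].
exists (fun u : {fset L} => choice.pickle (words (sort <=%O u))) => s s' ss ss' sz.
rewrite !sort_fset_seq // => /(pcan_inj choice.pickleK) E e re.
have : e \in words s.
  rewrite mem_filter; apply/andP; split; first exact/asboolP.
  have sze : size e == size s by rewrite -(realized_size re) size_map.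
  by apply/mapP; exists (Tuple sze); rewrite ?mem_enum.
by rewrite E mem_filter => /andP[/asboolP].
Qed.

(** The signs of a vanishing meet, read in increasing order, form the word; it is indexed by a
    sequence in [G] because it is there that it will be prolonged. *)
Lemma dependent_word dG dL dB (G : orderType dG) (L : orderType dL)
    (B : ctbDistrLatticeType dB) (a : L -> B) (A : set L) (g : G -> L) :
  (forall x y, x < y -> g x < g y) -> g @` [set: G] = A -> ~ independent a A ->
  exists t e, [/\ sorted <%O t, size t = size e &
    ~ realized [seq a x | x <- [seq g y | y <- t]] e].
Proof.
move=> gm gA /existsNP[u /existsNP[eps]] /not_implyP[_ /not_implyP[uA /contrapT u0]].
have [t Et] : exists t, sort <=%O u = [seq g y | y <- t].
  have : {in sort <=%O u, forall x, exists y, g y = x}.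
    by move=> x; rewrite mem_sort => /uA; rewrite -gA => -[y _ <-]; exists y.
  elim: (sort _ _) => [|x s IH] h; first by exists [::].
  have [|t ->] := IH; first by move=> z zs; apply: h; rewrite inE zs orbT.
  by have [|y <-] := h x; [rewrite mem_head|exists (y :: t)].
exists t, [seq eps x | x <- [seq g y | y <- t]]; split.
- have : sorted <%O (sort <=%O u) by rewrite sort_lt_sorted fset_uniq.
  rewrite Et sorted_map; apply: sub_sorted => x y /=.
  apply: contraTT; rewrite -!leNgt le_eqVlt => /predU1P[->//|/gm/ltW//].
- by rewrite !size_map.
rewrite realized_meets ?size_map // zip_map big_map; apply/negP; rewrite negbK -Et.
by rewrite (perm_big u) ?perm_sort //=; apply/eqP.
Qed.

Theorem theorem4 (dL dK dG dB : Order.disp_t)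
    (L : orderType dL) (K : orderType dK) (G : orderType dG)
    (hL : infinite_cardinal L) (hK : infinite_cardinal K)
    (hG : limit_ordinal G) (hR : Rrel G L K nat)
    (B : ctbDistrLatticeType dB) (a : L -> B) :
  [\/ exists2 A : set L, has_order_type A G & independent a A,
      exists (n : nat) (beta : K -> L),
        [/\ (0 < n)%N,
            forall v w : K, v < w -> beta v < beta w &
            let b := fun v : K =>
              \join_(k < n) \meet_(l < n)
                a (beta (ord_addn (ord_addn (ord_muln (n ^ 2)%N v) (n * k)%N) l))
            in forall v w : K, b v = b w] |
      exists s : K -> B, forall v w : K, v < w -> s w < s v].
Proof.
have [ind|nind] := pselect (exists2 A : set L, has_order_type A G & independent a A).
  exact: Or31.
have [woG [g0 _] noMaxG] := hG.
have [woK infK _] := hK; have noMaxK := infinite_cardinal_unbounded hK.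
have [k0 _] := infinite_setN0 infK.
have [c hc] := realized_colouring a.
have [A oA hA] := hR c.
have [g gm gA] := oA.
have {}gm x y : x < y -> g x < g y by apply: gm.
have nindA : ~ independent a A by move=> ind; apply: nind; exists A.
have [t [e [st sz nre]]] := dependent_word gm gA nindA.
(* [N] is the length that [block_const_or_chain] requires for [e]; it also bounds the size of
   [e]. *)
set k := (size e).*2; pose N := (thickness k * k.+2)%N.
have eN : (size e <= N)%N by have := thickness_gt0 k; rewrite /N /k; nia.
have [t' sz' stt'] := sorted_extend g0 (N - size e) woG noMaxG st.
pose r0 := [seq g y | y <- t ++ t'].
have sz0 : size r0 = N by rewrite size_map size_cat sz sz' subnKC.
have sr0 : sorted <%O r0.
  by rewrite sorted_map; apply: sub_sorted stt' => x y; apply: gm.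
(* The relation is applied to the prolonged set [r0] of size [N], so every [N]-element subset of [C]
   gets its colour. *)
have [|C [beta bm bC] hC] := hA [fset x in r0]%fset.
  by move=> x /=; rewrite !inE -gA => /mapP[y _ ->]; exists y.
have {}bm x y : x < y -> beta x < beta y by apply: bm.
have sbeta r : sorted <%O r -> sorted <%O [seq beta x | x <- r].
  by move=> sr; rewrite sorted_map; apply: sub_sorted sr.
have card_seq r : sorted <%O r -> #|` [fset x in r]%fset| = size r.
  by move=> /lt_sorted_uniq/undup_id; rewrite card_fseq => ->.
have cE r : sorted <%O r -> size r = N ->
    c [fset x in [seq beta x | x <- r]]%fset = c [fset x in r0]%fset.
  move=> sr szr; apply: hC.
    by move=> x /=; rewrite !inE -bC => /mapP[y _ ->]; exists y.
  by rewrite !card_seq ?sz0 ?size_map //; apply: sbeta.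
have hN r r' w : sorted <%O r -> sorted <%O r' -> size r = N -> size r' = N ->
    realized [seq a x | x <- [seq beta x | x <- r]] w ->
    realized [seq a x | x <- [seq beta x | x <- r']] w.
  move=> sr sr' szr szr'; apply: hc; rewrite ?size_map ?szr ?cE //; exact: sbeta.
pose a' := a \o beta.
(* Prolong both sequences and the word to length [N], transfer by equality of colours, then cut back
   to the prefix. *)
have hom w r r' : sorted <%O r -> sorted <%O r' -> size r = size r' ->
    (size r <= N)%N -> realized [seq a' x | x <- r] w -> realized [seq a' x | x <- r'] w.
  move=> sr sr' rr' rN hw; have szw := realized_size hw.
  have [p szp sp] := sorted_extend k0 (N - size r) woK noMaxK sr.
  have [p' szp' sp'] := sorted_extend k0 (N - size r) woK noMaxK sr'.
  have [w' szw'] := realized_extend [seq a' x | x <- p] hw.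
  rewrite -map_cat (map_comp a) => /(hN _ (r' ++ p')).
  rewrite !size_cat szp szp' -rr' subnKC // => /(_ sp sp' erefl erefl).
  rewrite -map_comp map_cat; apply: realized_prefix.
  by rewrite size_map -rr' -szw size_map.
(* If [e] occurred along [beta], its prolongation to length [N] would transfer to [r0], whose
   initial part [t] would realize [e]. *)
have nocc : ~ occurs a' e.
  move=> [r sr hr]; have := realized_size hr; rewrite size_map => szr.
  have [p szp sp] := sorted_extend k0 (N - size e) woK noMaxK sr.
  have [w' szw'] := realized_extend [seq a' x | x <- p] hr.
  rewrite -map_cat (map_comp a) => /(hc _ r0); apply: contra_not nre => H.
  have : realized [seq a x | x <- r0] (e ++ w').
    have szrp : size (r ++ p) = N by rewrite size_cat szp szr subnKC.
    by apply: H => //; [apply: sbeta|rewrite size_map szrp|apply: cE].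
  by rewrite /r0 !map_cat; apply: realized_prefix; rewrite !size_map.
have [[n n0 hn]|hs] := block_const_or_chain woK noMaxK k0 hom (leqnn _) nocc.
  by apply: Or32; exists n, beta; split.
exact: Or33.
Qed.
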